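(* Let $X,Y,Z,W$ be observed random variables and $U$ a latent random variable satisfying the confounding bridge and completeness assumptions (A1) and (A2) given in the context, with confounding bridge functions $h_0$ and $g_0$. Then the marginal moment condition $$\operatorname{cov}(Y,X)=\operatorname{cov}\{h_0(W),X\}=\operatorname{cov}\{g_0(Z),X\}$$ reduces to the classical tetrad constraint $$\sigma_{XY}\sigma_{ZW}=\sigma_{XZ}\sigma_{YW}=\sigma_{XW}\sigma_{YZ}$$ when the confounding bridge functions $g_0,h_0$ are linear in $Z,W$, respectively.
   Context: $\sigma_{AB}$ denotes the covariance between random variables $A$ and $B$. ''Linear'' allows an intercept, i.e. $h_0(w)=\tau_0+\tau_1w$ and $g_0(z)=\kappa_0+\kappa_1z$ for constants $\tau_0,\tau_1,\kappa_0,\kappa_1$. (A1) (Confounding bridge) (i) $h_0=h_0(w)$ is a square-integrable function such that for all $z$, $E(Y\mid U,Z=z)=E\{h_0(W)\mid U,Z=z\}$; (ii) $g_0=g_0(z)$ is a square-integrable function such that for all $w$, $E(Y\mid U,W=w)=E\{g_0(Z)\mid U,W=w\}$. Such functions $h_0$ and $g_0$ are called the confounding bridge functions. (A2) (Completeness) (i) for any square-integrable function $l$, $E\{l(W)\mid Z\}=0$ almost surely if and only if $l(W)=0$ almost surely; (ii) for any square-integrable function $l$, $E\{l(Z)\mid W\}=0$ almost surely if and only if $l(Z)=0$ almost surely.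
   Formalization: ''Reduces to'' is read as: the moment condition always implies the tetrad constraint, and the converse holds when σ_ZW ≠ 0; without that condition the converse fails, since the tetrad constraint then holds trivially. X, Y, Z, W are taken square-integrable. *)

(* Defs.v *)
From HB Require Import structures.
From mathcomp Require Export all_boot all_order all_algebra.
From mathcomp Require Export all_classical all_reals all_analysis.

Set Implicit Arguments.
Unset Strict Implicit.
Unset Printing Implicit Defensive.

Import Order.TTheory GRing.Theory Num.Theory.
Local Open Scope classical_set_scope.
Local Open Scope ring_scope.

(* [m] is a version of the regression function v |-> E(A | V = v), that is,
   m \o V is a version of E(A | sigma(V)): the sets V @^-1` B, with B
   measurable, are exactly the members of sigma(V). *)
Definition is_regression d dV (T : measurableType d) (S : measurableType dV)
    (R : realType) (P : probability T R) (V : T -> S) (A : T -> R)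
    (m : S -> R) : Prop :=
  [/\ P.-integrable setT (EFin \o A),
      measurable_fun setT m,
      P.-integrable setT (EFin \o (m \o V)) &
      forall B : set S, measurable B ->
        (\int[P]_(t in V @^-1` B) (A t)%:E =
         \int[P]_(t in V @^-1` B) (m (V t))%:E)%E].

(* [h] is a confounding bridge function for Y through the proxy W, with
   secondary proxy Z:
     E(Y | U = u, Z = z) = E(h(W) | U = u, Z = z)   for all u and z.
   Conditional expectations being defined up to null sets, the equality means
   that the two sides have a common version. Square integrability of [h] refers
   to the law of W. *)
Definition confounding_bridge d dU (T : measurableType d)
    (TU : measurableType dU) (R : realType) (P : probability T R)
    (U : T -> TU) (Y Z W : T -> R) (h : R -> R) : Prop :=
  [/\ measurable_fun setT h,
      h \o W \in Lfun P 2%:E &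
      exists m : TU * R -> R,
        is_regression P (fun t => (U t, Z t)) Y m /\
        is_regression P (fun t => (U t, Z t)) (h \o W) m].

(* Completeness of W given Z: E(l(W) | Z) = 0 a.s. iff l(W) = 0 a.s., for every
   square-integrable l. *)
Definition complete_given d (T : measurableType d) (R : realType)
    (P : probability T R) (Z W : T -> R) : Prop :=
  forall l : R -> R, measurable_fun setT l -> l \o W \in Lfun P 2%:E ->
    (exists2 m : R -> R, is_regression P Z (l \o W) m &
       {ae P, forall t, m (Z t) = 0}) <->
    {ae P, forall t, l (W t) = 0}.

Definition linear_with_intercept (R : realType) (h : R -> R) : Prop :=
  exists a b : R, forall x, h x = a + b * x.

Definition moment_condition d (T : measurableType d) (R : realType)
    (P : probability T R) (X Y Z W : T -> R) (h g : R -> R) : Prop :=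
  covariance P Y X = covariance P (h \o W) X /\
  covariance P (h \o W) X = covariance P (g \o Z) X.

Definition tetrad_constraint d (T : measurableType d) (R : realType)
    (P : probability T R) (X Y Z W : T -> R) : Prop :=
  (covariance P X Y * covariance P Z W =
     covariance P X Z * covariance P Y W)%E /\
  (covariance P X Z * covariance P Y W =
     covariance P X W * covariance P Y Z)%E.

(* Main.v *)
Require Import Defs.
From mathcomp Require Import measurable_realfun.

(* Since E(Y | U, Z) = E(h0(W) | U, Z), testing against the square-integrable
   sigma(U, Z)-measurable variable Z gives cov(Y, Z) = cov(h0(W), Z), which is
   tau1 * cov(W, Z) when h0 has slope tau1. Symmetrically
   cov(Y, W) = kappa1 * cov(Z, W). Hence multiplying the moment condition
   cov(Y, X) = tau1 * cov(W, X) = kappa1 * cov(Z, X) by cov(Z, W) yields the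
   tetrad constraint, and dividing by it goes back. *)

Set Implicit Arguments.
Unset Strict Implicit.
Unset Printing Implicit Defensive.

Import Order.TTheory GRing.Theory Num.Theory.
Local Open Scope classical_set_scope.
Local Open Scope ring_scope.
Import HBSimple HBNNSimple.

Lemma integral_mul_sfun_eq0 (d dV : measure_display) (T : measurableType d)
    (S : measurableType dV) (R : realType) (mu : {measure set T -> \bar R})
    (V : T -> S) (D : T -> R) (s : {nnsfun S >-> R}) :
  measurable_fun setT V -> mu.-integrable setT (EFin \o D) ->
  (forall B, measurable B -> \int[mu]_(t in V @^-1` B) (D t)%:E = 0)%E ->
  (\int[mu]_t (D t * s (V t))%:E = 0)%E.
Proof.
move=> mV iD D0.
have mVs y : measurable (V @^-1` (s @^-1` [set y])).
  by rewrite -[_ @^-1` _]setTI; exact: mV.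
have iDs y :
    mu.-integrable setT (fun t => (D t * \1_(s @^-1` [set y]) (V t))%:E).
  (* [D] times the indicator is the restriction of [D] to a measurable set. *)
  have := integrable_mkcond (EFin \o D) (mVs y).
  rewrite epatch_indic => /(_ mu)[+ _]; apply.
  exact: integrableS iD.
under eq_integral do rewrite fimfunEord mulr_sumr -sumEFin.
rewrite integral_sum//=; last first.
  by move=> i; under eq_fun do rewrite mulrCA EFinM; exact: integrableZl.
rewrite big1// => i _; set y := _`_i.
under eq_integral do rewrite mulrCA EFinM.
rewrite integralZl// -[X in (_ * X)%E](_ : 0%E = _) ?mule0//.
rewrite -(D0 (s @^-1` [set y]))//.
by rewrite integral_mkcond -[fun x => (D x)%:E]/(EFin \o D) epatch_indic.
Qed.

(** Simple functions increasing to [phi] reduce this to the previous case. Dominated convergence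
    applies with bound [|D * phi(V)|], so [phi] may be unbounded. *)
Lemma integral_mul_nonneg_eq0 (d dV : measure_display) (T : measurableType d)
    (S : measurableType dV) (R : realType) (mu : {measure set T -> \bar R})
    (V : T -> S) (D : T -> R) (phi : S -> R) :
  measurable_fun setT V -> mu.-integrable setT (EFin \o D) ->
  measurable_fun setT phi -> (forall v, 0 <= phi v) ->
  mu.-integrable setT (fun t => (D t * phi (V t))%:E) ->
  (forall B, measurable B -> \int[mu]_(t in V @^-1` B) (D t)%:E = 0)%E ->
  (\int[mu]_t (D t * phi (V t))%:E = 0)%E.
Proof.
move=> mV iD mphi phi0 iDphi D0.
have mEphi : measurable_fun setT (EFin \o phi) by exact/measurable_EFinP.
have Ephi0 v : setT v -> (0 <= (EFin \o phi) v)%E by rewrite lee_fin.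
pose s := nnsfun_approx measurableT mEphi.
have mD : measurable_fun setT D by exact/measurable_EFinP/(measurable_int mu).
have [] := @dominated_convergence _ _ _ mu setT measurableT
  (fun n t => (D t * s n (V t))%:E) (fun t => (D t * phi (V t))%:E)
  (fun t => `|(D t * phi (V t))%:E|%E).
- move=> n; apply/measurable_EFinP/measurable_funM => //.
  exact: measurableT_comp.
- apply/measurable_EFinP/measurable_funM => //.
  exact: measurableT_comp.
- apply: aeW => t _.
  under eq_fun do rewrite EFinM.
  rewrite EFinM; apply: cvgeZl => //.
  exact: (cvg_nnsfun_approx measurableT mEphi Ephi0).
- exact: integrable_abse.
- apply: aeW => t n _ /=.
  rewrite lee_fin !normrM ler_wpM2l// !ger0_norm//.
  by rewrite -lee_fin nnsfun_approxE (le_approx _ Ephi0).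
(* The approximating integrals are all 0, hence so is their limit. *)
move=> _ _; under [X in X @ _]eq_fun do rewrite integral_mul_sfun_eq0//.
by move/(cvg_lim (@ereal_hausdorff R)) => <-; exact: lim_cst.
Qed.

(** Split [phi] into positive and negative parts; both are bounded by [|phi|], so their products
    with [D] stay integrable. *)
Lemma integral_mul_eq0 (d dV : measure_display) (T : measurableType d)
    (S : measurableType dV) (R : realType) (mu : {measure set T -> \bar R})
    (V : T -> S) (D : T -> R) (phi : S -> R) :
  measurable_fun setT V -> mu.-integrable setT (EFin \o D) ->
  measurable_fun setT phi ->
  mu.-integrable setT (fun t => (D t * phi (V t))%:E) ->
  (forall B, measurable B -> \int[mu]_(t in V @^-1` B) (D t)%:E = 0)%E ->
  (\int[mu]_t (D t * phi (V t))%:E = 0)%E.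
Proof.
move=> mV iD mphi iDphi D0.
have mD : measurable_fun setT D by exact/measurable_EFinP/(measurable_int mu).
have iDpsi (psi : S -> R) : measurable_fun setT psi ->
    (forall v, `|psi v| <= `|phi v|) ->
    mu.-integrable setT (fun t => (D t * psi (V t))%:E).
  move=> mpsi lepsi; apply: le_integrable iDphi => //.
    by apply/measurable_EFinP/measurable_funM => //; exact: measurableT_comp.
  by move=> t _; rewrite /= lee_fin !normrM ler_wpM2l.
have lepos v : `|phi^\+ v| <= `|phi v|.
  by rewrite ger0_norm ?funrpos_ge0// ge_max normr_ge0 ler_norm.
have leneg v : `|phi^\- v| <= `|phi v|.
  by rewrite ger0_norm ?funrneg_ge0// ge_max normr_ge0 -normrN ler_norm.
have mpos := measurable_funrpos mphi.
have mneg := measurable_funrneg mphi.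
have DphiE t : D t * phi (V t) = D t * phi^\+ (V t) - D t * phi^\- (V t).
  by rewrite -mulrBr -[in LHS](funrposBneg phi).
under eq_integral do rewrite DphiE EFinB.
rewrite integralB_EFin//; [|exact: iDpsi..].
by rewrite !integral_mul_nonneg_eq0 ?sube0//; exact: iDpsi.
Qed.

(** The difference [A - B] integrates to 0 over every set of sigma(V), since [A] and [B] both
    integrate there like [m \o V]. *)
Lemma integral_mul_regression (d dV : measure_display) (T : measurableType d)
    (S : measurableType dV) (R : realType) (P : probability T R)
    (V : T -> S) (A B : T -> R) (m phi : S -> R) :
  measurable_fun setT V -> measurable_fun setT phi ->
  is_regression P V A m -> is_regression P V B m ->
  P.-integrable setT (fun t => (A t * phi (V t))%:E) ->
  P.-integrable setT (fun t => (B t * phi (V t))%:E) ->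
  (\int[P]_t (A t * phi (V t))%:E = \int[P]_t (B t * phi (V t))%:E)%E.
Proof.
move=> mV mphi [iA _ _ Am] [iB _ _ Bm] iAphi iBphi.
have fA := integrable_fin_num measurableT iAphi.
have fB := integrable_fin_num measurableT iBphi.
(* Finiteness of both integrals lets the equality in the extended reals be restated as a vanishing
   difference. *)
rewrite -[RHS]add0e; apply/eqP; rewrite -sube_eq ?fin_num_adde_defl//.
rewrite -integralB_EFin//.
under eq_integral do rewrite -EFinB -mulrBl.
apply/eqP/(integral_mul_eq0 (D := A \- B)) => //.
- exact: integrableB iA iB.
- under eq_fun do rewrite /= mulrBl EFinB.
  exact: integrableB iAphi iBphi.
- move=> C mC.
  have mVC : measurable (V @^-1` C) by rewrite -[_ @^-1` _]setTI; exact: mV.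
  rewrite integralB_EFin//; [|exact: integrableS iA|exact: integrableS iB].
  rewrite Am// Bm// subee// -Bm// integrable_fin_num//.
  exact: integrableS iB.
Qed.

Section covariance_regression.
Context (d : measure_display) (T : measurableType d) (R : realType).
Variable P : probability T R.

Lemma Lfun2_Lfun1 (f : T -> R) : f \in Lfun P 2%:E -> f \in Lfun P 1.
Proof. by apply: Lfun_subset12; exact: fin_num_measure. Qed.

(** A common regression function forces equal means and equal mixed moments with [phi \o V]; square
    integrability makes the products integrable. *)
Lemma covariance_regression (dV : measure_display) (S : measurableType dV)
    (V : T -> S) (A B : T -> R) (m phi : S -> R) :
  measurable_fun setT V -> measurable_fun setT phi ->
  is_regression P V A m -> is_regression P V B m ->
  A \in Lfun P 2%:E -> B \in Lfun P 2%:E -> phi \o V \in Lfun P 2%:E ->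
  covariance P A (phi \o V) = covariance P B (phi \o V).
Proof.
move=> mV mphi rA rB A2 B2 phi2.
have E1 : ('E_P[A] = 'E_P[B])%E.
  rewrite unlock; case: rA rB => [_ _ _ Am] [_ _ _ Bm].
  (* The mean is the integral over the preimage of the whole space. *)
  by rewrite -(preimage_setT V) Am// Bm.
have EM : ('E_P[(A * (phi \o V))%R] = 'E_P[(B * (phi \o V))%R])%E.
  rewrite unlock; apply: (integral_mul_regression mV mphi rA rB).
    exact/Lfun1_integrable/Lfun2_mul_Lfun1.
  exact/Lfun1_integrable/Lfun2_mul_Lfun1.
by rewrite !covarianceE ?Lfun2_mul_Lfun1 ?Lfun2_Lfun1// EM E1.
Qed.

Lemma covariance_affine (a b : R) (h : R -> R) (A B : T -> R) :
  (forall x, h x = a + b * x) ->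
  A \in Lfun P 2%:E -> B \in Lfun P 2%:E ->
  covariance P (h \o A) B = (b%:E * covariance P A B)%E.
Proof.
move=> hE A2 B2.
have -> : h \o A = (b \o* A) \+ cst a.
  by apply/funext => t /=; rewrite hE addrC mulrC.
rewrite covarianceDl//; last 2 first.
- by rewrite Lfun_scale// ler1n.
- exact: Lfun_cst.
by rewrite covariance_cst_l adde0 covarianceZl ?Lfun2_mul_Lfun1 ?Lfun2_Lfun1.
Qed.

(** [Z] is the second coordinate of the conditioning pair [(U, Z)], so [phi] can be [snd]. *)
Lemma bridge_covariance (dU : measure_display) (TU : measurableType dU)
    (U : T -> TU) (Y Z W : T -> R) (h : R -> R) :
  measurable_fun setT U -> Y \in Lfun P 2%:E -> Z \in Lfun P 2%:E ->
  confounding_bridge P U Y Z W h ->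
  covariance P Y Z = covariance P (h \o W) Z.
Proof.
move=> mU Y2 Z2 [mh h2 [m [rY rh]]].
have mZ : measurable_fun setT Z by move: Z2 => /sub_Lfun_mfun; rewrite inE.
apply: (covariance_regression (phi := snd) _ _ rY rh) => //.
exact/measurable_fun_pair.
Qed.

End covariance_regression.

Theorem proposition1 (d dU : measure_display) (T : measurableType d)
    (TU : measurableType dU) (R : realType) (P : probability T R)
    (X Y Z W : {RV P >-> R}) (U : {mfun T >-> TU}) (h0 g0 : R -> R)
    (X2 : (X : T -> R) \in Lfun P 2%:E) (Y2 : (Y : T -> R) \in Lfun P 2%:E)
    (Z2 : (Z : T -> R) \in Lfun P 2%:E) (W2 : (W : T -> R) \in Lfun P 2%:E)
    (A1i : confounding_bridge P U Y Z W h0)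
    (A1ii : confounding_bridge P U Y W Z g0)
    (A2i : complete_given P Z W) (A2ii : complete_given P W Z)
    (h0_lin : linear_with_intercept h0) (g0_lin : linear_with_intercept g0) :
  (moment_condition P X Y Z W h0 g0 -> tetrad_constraint P X Y Z W) /\
  (covariance P Z W != 0%E ->
     tetrad_constraint P X Y Z W -> moment_condition P X Y Z W h0 g0).
Proof.
have mU : measurable_fun setT U by [].
have YZ := bridge_covariance mU Y2 Z2 A1i.
have YW := bridge_covariance mU Y2 W2 A1ii.
case: h0_lin g0_lin => [a [b hE]] [k [l gE]].
rewrite /moment_condition /tetrad_constraint.
rewrite (covarianceC P X Y) (covarianceC P X Z) (covarianceC P X W).
rewrite {}YZ {}YW !(covariance_affine hE) ?(covariance_affine gE)//.
rewrite (covarianceC P W Z).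
have cov_fin (A B : T -> R) : A \in Lfun P 2%:E -> B \in Lfun P 2%:E ->
    covariance P A B \is a fin_num.
  by move=> *; rewrite covariance_fin_num ?Lfun2_mul_Lfun1 ?Lfun2_Lfun1.
move: (cov_fin _ _ Y2 X2) (cov_fin _ _ W2 X2) (cov_fin _ _ Z2 X2)
      (cov_fin _ _ Z2 W2).
(* Only these four covariances remain. All are finite, so the claim becomes real algebra: the moment
   condition is [yx = b * wx = l * zx], and the tetrad is
   [yx * zw = zx * (l * zw) = wx * (b * zw)]. *)
move: (covariance P Y X) (covariance P W X) (covariance P Z X) (covariance P Z W).
move=> [yx||]// [wx||]// [zx||]// [zw||]// _ _ _ _.
rewrite -!EFinM eqe; split=> [[[->] [bl]]|zw0 [[e1] [e2]]]; split; congr EFin => //.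
- by rewrite bl -mulrA mulrCA.
- by rewrite mulrA [zx * l]mulrC -bl -mulrA mulrCA.
(* For the converse, the common factor [zw] is cancelled. *)
- by apply: (mulIf zw0); rewrite e1 e2 mulrCA mulrA.
- by apply: (mulIf zw0); rewrite -!mulrA mulrCA -e2 mulrCA.
Qed.
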